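(* Let $p$ be an odd prime and let $k$ and $\ell$ be positive integers such that $k$ does not divide $\ell$. Then the $L$-polynomial $L(C_k)$ does not divide the $L$-polynomial $L(C_\ell)$.
   Context: For a positive integer $k$, $C_k$ denotes the smooth projective absolutely irreducible curve over $\mathbb{F}_p$ with affine equation $y^p-y=x^{p^k+1}+x$. It has genus $p^k(p-1)/2$ and exactly one point at infinity, which is rational, so $\#C_k(\mathbb{F}_{p^n})$ is $1$ plus the number of solutions $(x,y)\in\mathbb{F}_{p^n}^2$ of the affine equation. $L(C_k)$ is the $L$-polynomial of $C_k$ over $\mathbb{F}_p$, i.e. $L(C_k)=\exp\left(\sum_{n\ge1}(\#C_k(\mathbb{F}_{p^n})-p^n-1)\frac{T^n}{n}\right)$, a polynomial in $T$ of degree twice the genus with integer coefficients. *)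

(* Defs.v *)
From HB Require Import structures.
From mathcomp Require Import all_boot all_order all_algebra all_field.

Set Implicit Arguments.
Unset Strict Implicit.
Unset Printing Implicit Defensive.

Import Order.TTheory GRing.Theory Num.Theory.
Local Open Scope ring_scope.

(* The field with p ^ n.+1 elements; the shift keeps the degree positive. *)
Definition GFpS (p : nat) (pr_p : prime p) (n : nat) : finFieldType :=
  s2val (pPrimePowerField pr_p (ltn0Sn n)).

(* The successor accounts for the unique point at infinity, which is rational. *)
Definition curve_card (p k : nat) (F : finFieldType) : nat :=
  #|[set P : F * F | P.2 ^+ p - P.2 == P.1 ^+ (p ^ k).+1 + P.1]|.+1.

(* The coefficient of T ^ n in
   \sum_(n >= 1) (#C_k(F_(p ^ n)) - p ^ n - 1) T ^ n / n. *)
Definition log_coef (p : nat) (pr_p : prime p) (k n : nat) : rat :=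
  if n is m.+1 then
    ((curve_card p k (GFpS pr_p m))%:R - (p ^ n)%:R - 1) / n%:R
  else 0.

(* The coefficient of T ^ n in the formal power series
   exp (\sum_(i >= 1) c i T ^ i) = \sum_j (\sum_(i >= 1) c i T ^ i) ^ j / j!,
   meant for c with c 0 = 0: terms with i > n or j > n do not contribute. *)
Definition exp_coef (c : nat -> rat) (n : nat) : rat :=
  (\sum_(j < n.+1) (j`!%:R)^-1 *: (\poly_(i < n.+1) c i) ^+ j)`_n.

(* L is the L-polynomial of C_k over F_p: an equality of formal power series,
   which determines L; such an L exists by the rationality of the zeta function. *)
Definition is_Lpoly (p : nat) (pr_p : prime p) (k : nat) (L : {poly rat}) : Prop :=
  forall n : nat, L`_n = exp_coef (log_coef pr_p k) n.

(* Main.v *)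
Require Import Defs.
From mathcomp Require Import all_boot all_order all_algebra all_field.
From mathcomp Require Import zify ring.
Import Order.TTheory GRing.Theory Num.Theory.
Local Open Scope ring_scope.

(* Write [E] for #C_k(F_(p^n)) - p^n - 1.  By additive counting, [E] is the sum
   over x in F_(p^n) of e(x^(p^k+1) + x), where e(z) is #{y | y^p - y = z} - 1.
   Weyl differencing turns the square of this sum into a sum of e over the
   radical W = {z | z^(p^(2k)) = - z} of the quadratic form tr(x^(p^k+1)).
   If k does not divide m then W has at most p^k elements in F_(p^(4m)), so E is
   small there.  If n = 4kj then W has p^(2k) elements, so E is known up to sign
   once the linear term is removed by x := x - 1/2; the sign follows from the
   invariance of the form under the (p^k+1)-st roots of unity.

   For the L-polynomials: over F_(p^(4l)) the power sums of C_l show that its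
   normalised Frobenius eigenvalues u satisfy u = 1 if p divides l, and
   1 + u + ... + u^(p-1) = 0 otherwise.  If L(C_k) divides L(C_l), those of C_k
   satisfy the same equation.  So E is maximal for C_k over F_(p^(4lp)), and large
   over F_(p^(4lj)) for some 0 < j < p; hence k divides both lp and lj, thus l. *)

Set Implicit Arguments.
Unset Strict Implicit.
Unset Printing Implicit Defensive.

Lemma sum_const_int (T : finType) (c : int) : \sum_(x : T) c = #|T|%:Z * c.
Proof. by rewrite sumr_const -mulr_natl natz; congr (_%:Z * c); apply: eq_card. Qed.

(** * Root counts in a finite field *)

Section FiniteField.

Variable F : finFieldType.

(** ['X^#|F| - 'X] is the product of ['X - x] over all [x] in [F], so a divisor is, up to a unit, a
    subproduct with distinct roots. *)
Lemma card_roots_dvd (g : {poly F}) :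
  g %| 'X^#|F| - 'X -> #|[set x | root g x]| = (size g).-1.
Proof.
rewrite finField_genPoly -(big_enum _ _ _ (fun x => 'X - x%:P)) /=.
case/dvdp_prod_XsubC => m; set s := mask m _ => g_eq.
have s_uniq : uniq s by rewrite mask_uniq // enum_uniq.
rewrite (eqp_size g_eq) size_prod_XsubC /= -(card_uniqP s_uniq).
apply: eq_card => x; rewrite inE (eqp_root g_eq) root_prod_XsubC.
by [].
Qed.

Lemma dvdp_subX_subXX (x y : {poly F}) (n : nat) : x - y %| x ^+ n - y ^+ n.
Proof. by rewrite subrXX dvdp_mulr. Qed.

Lemma card_roots_XnsubC (d : nat) (t : F) :
  (0 < d)%N -> (d %| #|F|.-1)%N -> t ^+ (#|F|.-1 %/ d) = 1 ->
  #|[set x : F | x ^+ d == t]| = d.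
Proof.
move=> d_gt0 /dvdnP[c Ec]; rewrite {1}Ec mulnK // => tc.
have F_gt0 : (0 < #|F|)%N by apply/card_gt0P; exists 0.
rewrite -[RHS]/(d.+1.-1) -(size_XnsubC t d_gt0) -card_roots_dvd.
  by apply: eq_card => x; rewrite !inE rootE !hornerE subr_eq0.
have -> : 'X^#|F| - 'X = 'X * ('X^d ^+ c - t%:P ^+ c) :> {poly F}.
  by rewrite -polyC_exp tc -exprM mulnC -Ec mulrBr mulr1 -exprS prednK.
by rewrite dvdp_mull // dvdp_subX_subXX.
Qed.

(** Each nonempty fibre of [x ^+ d] on the nonzero elements is a coset of the group of [d]-th roots
    of unity, which has order [d]. *)
Lemma sum_nonzero_exp (d : nat) (g : F -> int) :
  (0 < d)%N -> (d %| #|F|.-1)%N ->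
  (d%:Z %| \sum_(x : F | x != 0%R) g (x ^+ d))%Z.
Proof.
move=> d_gt0 dvd_d.
rewrite (partition_big (fun x : F => x ^+ d) predT) //=.
apply: rpred_sum => v _.
rewrite (eq_bigr (fun=> g v)) => [|x /andP[_ /eqP->]] //.
rewrite sumr_const -mulr_natl; apply: dvdz_mulr.
have [x0 /andP[x0_neq0 /eqP Ev] | noroot] := pickP [pred x : F | (x != 0) && (x ^+ d == v)]; last first.
  by rewrite eq_card0 ?dvdz0 // => x; have := noroot x.
suff -> : #|[pred x : F | (x != 0) && (x ^+ d == v)]| = d by rewrite natz dvdzz.
rewrite -[RHS](@card_roots_XnsubC d 1) ?expr1n //.
rewrite -(card_imset _ (mulfI x0_neq0)); apply: eq_card => x.
apply/andP/imsetP => [[x_neq0 /eqP xd]|[y]].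
  exists (x / x0); last by rewrite mulrC divfK.
  by rewrite inE expr_div_n xd -Ev divff // expf_neq0.
rewrite inE => /eqP yd ->; rewrite exprMn yd mulr1 Ev eqxx; split=> //.
rewrite mulf_neq0 //; apply: contra_eq_neq yd => /= ->.
by rewrite expr0n gtn_eqF // eq_sym oner_eq0.
Qed.

(** * The Artin-Schreier map and its fibre counts *)

Variables (p n : nat) (p_prime : prime p) (cardF : #|F| = (p ^ n)%N).

Let charF : p \in [pchar F] := card_finPcharP cardF p_prime.

Definition wp (y : F) : F := y ^+ p - y.

(** By orthogonality this is the sum of psi(tr x) over the nontrivial additive characters psi of the
    prime field; character sums thus stay inside the integers. *)
Definition wp_defect (x : F) : int := (#|[set y | wp y == x]|)%:Z - 1.
Local Notation e := wp_defect.

Lemma pFrobD (i : nat) (x y : F) : (x + y) ^+ (p ^ i) = x ^+ (p ^ i) + y ^+ (p ^ i).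
Proof. by apply: exprDn_pchar; rewrite pnatX pnatE ?charF. Qed.

Lemma pFrobN (i : nat) (x : F) : (- x) ^+ (p ^ i) = - x ^+ (p ^ i).
Proof.
apply: (addrI (x ^+ (p ^ i))).
by rewrite subrr -pFrobD subrr expr0n expn_eq0 (gtn_eqF (prime_gt0 p_prime)).
Qed.

Lemma pFrobB (i : nat) (x y : F) : (x - y) ^+ (p ^ i) = x ^+ (p ^ i) - y ^+ (p ^ i).
Proof. by rewrite pFrobD pFrobN. Qed.

Lemma pFrob_inj (i : nat) : injective (fun x : F => x ^+ (p ^ i)).
Proof.
move=> x y /= /eqP; rewrite -subr_eq0 -pFrobB expf_eq0 => /andP[_].
by rewrite subr_eq0 => /eqP.
Qed.

Lemma pFrob_nat (i m : nat) : m%:R ^+ (p ^ i) = m%:R :> F.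
Proof.
elim: i => [|i IH]; first by rewrite expr1.
rewrite expnSr exprM IH.
elim: m {IH} => [|m IH]; first by rewrite expr0n (gtn_eqF (prime_gt0 p_prime)).
by rewrite -addn1 natrD -{1}(expn1 p) pFrobD expn1 IH expr1n.
Qed.

Lemma wpD (x y : F) : wp (x + y) = wp x + wp y.
Proof. by rewrite /wp -{1}(expn1 p) pFrobD expn1; ring. Qed.

Lemma wpN (x : F) : wp (- x) = - wp x.
Proof. by rewrite /wp -{1}(expn1 p) pFrobN expn1; ring. Qed.

Lemma wpM (t x : F) : t ^+ p = t -> wp (t * x) = t * wp x.
Proof. by move=> tp; rewrite /wp exprMn tp mulrBr. Qed.

Lemma sum_wp_fiber (g : F -> int) :
  \sum_x (#|[set y | wp y == x]|)%:Z * g x = \sum_y g (wp y).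
Proof.
rewrite [RHS](partition_big wp predT) //=; apply: eq_bigr => x _.
rewrite (eq_bigr (fun=> g x)) => [|y /eqP->] //.
rewrite sumr_const -mulr_natl natz; congr (_%:Z * _).
by apply: eq_card => y; rewrite inE.
Qed.

Lemma sum_defect_mul (g : F -> int) :
  \sum_x e x * g x = \sum_y g (wp y) - \sum_x g x.
Proof.
by rewrite -sum_wp_fiber -sumrB; apply: eq_bigr => x _; rewrite mulrBl mul1r.
Qed.

Lemma sum_defect : \sum_x e x = 0.
Proof.
under eq_bigr => x _ do rewrite -[e x]mulr1.
by rewrite (sum_defect_mul (fun=> 1)) subrr.
Qed.

Lemma defect_wp (x y : F) : e (x + wp y) = e x.
Proof.
congr (_%:Z - 1); rewrite -[RHS](card_imset _ (addrI y)).
apply: eq_card => z; rewrite inE; apply/eqP/imsetP => [Ez|[u]].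
  by exists (z - y); rewrite ?inE ?wpD ?wpN ?Ez ?addrK // addrC subrK.
by rewrite inE => /eqP <- ->; rewrite wpD addrC.
Qed.

(** Consecutive Frobenius powers of [a] differ by a value of [wp]; this is the Frobenius invariance
    of the trace. *)
Lemma defect_frob (x a : F) (i : nat) : e (x + a ^+ (p ^ i)) = e (x + a).
Proof.
elim: i => [|i <-]; first by rewrite expr1.
rewrite -[RHS](defect_wp _ (a ^+ (p ^ i))); congr e.
by rewrite /wp expnSr exprM; ring.
Qed.

Lemma defect_scale (t x : F) : t ^+ p = t -> t != 0 -> e (t * x) = e x.
Proof.
move=> tp t0; congr (_%:Z - 1); rewrite -[RHS](card_imset _ (mulfI t0)).
have tVp : t^-1 ^+ p = t^-1 by rewrite exprVn tp.
apply: eq_card => z; rewrite inE; apply/eqP/imsetP => [Ez|[u]].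
  by exists (t^-1 * z); rewrite ?inE ?wpM ?Ez ?mulKf ?mulVKf.
by rewrite inE => /eqP <- ->; rewrite wpM.
Qed.

Lemma sum_defect_affine (c b : F) (i : nat) :
  \sum_x e (c + x ^+ (p ^ i) * b) = if b == 0 then #|F|%:Z * e c else 0.
Proof.
case: eqVneq => [->|b0].
  under eq_bigr do rewrite mulr0 addr0.
  by rewrite sum_const_int.
rewrite -[RHS]sum_defect [RHS](reindex_inj (h := fun x => c + x ^+ (p ^ i) * b)) //=.
by move=> x y /addrI/(mulIf b0)/pFrob_inj.
Qed.

(** One factor is expanded as a fibre count minus 1. The count yields shifts by [wp y], which [e]
    ignores; the -1 contributes a full sum of [e], which is 0. *)
Lemma sum_defect_conv (a b : F) : \sum_s e (a - s) * e (b - s) = #|F|%:Z * e (b - a).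
Proof.
rewrite (reindex_inj (subrI a)) /=.
under eq_bigr do rewrite subKr.
rewrite (sum_defect_mul (fun s => e (b - (a - s)))).
have -> : \sum_x e (b - (a - x)) = 0.
  rewrite -[RHS]sum_defect [RHS](reindex_inj (addrI (b - a))) /=.
  by apply: eq_bigr => x _; congr e; ring.
rewrite subr0 (eq_bigr (fun=> e (b - a))) => [|y _]; last first.
  by rewrite -[RHS](defect_wp _ y); congr e; ring.
by rewrite sum_const_int.
Qed.

Lemma card_wp0 : #|[set y | wp y == 0]| = p.
Proof.
have p2 := prime_gt1 p_prime.
have sz : size ('X^p - 'X : {poly F}) = p.+1.
  by rewrite size_polyDl ?size_polyXn // size_polyN size_polyX.
rewrite -[RHS]/(p.+1.-1) -sz -card_roots_dvd.
  by apply: eq_card => x; rewrite !inE rootE !hornerE.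
rewrite cardF; elim: n => [|i IH]; first by rewrite expr1 subrr dvdp0.
have := dvdp_subX_subXX ('X^(p ^ i)) 'X p.
rewrite -exprM -expnSr => dvd1; rewrite -(subrKA 'X^p 'X^(p ^ i.+1)) dvdp_add //.
exact: (dvdp_trans IH).
Qed.

Definition in_wp (x : F) : bool := [exists y, wp y == x].

Lemma defect_in (x : F) : in_wp x -> e x = p%:Z - 1.
Proof.
by case/existsP=> y /eqP <-; rewrite -[wp y]add0r defect_wp /wp_defect card_wp0.
Qed.

Lemma defect_notin (x : F) : ~~ in_wp x -> e x = -1.
Proof.
rewrite negb_exists => /forallP notx.
by rewrite /wp_defect eq_card0 // => y; rewrite inE; apply: negbTE.
Qed.

Lemma defect_le (x : F) : e x <= p%:Z - 1.
Proof.
by have [/defect_in->|/defect_notin->] := boolP (in_wp x) => //; lia.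
Qed.

Lemma card_wp_fiber_le (x : F) : (#|[set y | wp y == x]| <= p)%N.
Proof. by have := defect_le x; rewrite /wp_defect; lia. Qed.

Lemma in_wp0 : in_wp 0.
Proof. by apply/existsP; exists 0; rewrite /wp expr0n (gtn_eqF (prime_gt0 p_prime)) subrr. Qed.

Lemma exists_notin_wp : exists r, ~~ in_wp r.
Proof.
apply/existsP; rewrite -negb_forall; apply/negP => /forallP all_in.
have := sum_defect; rewrite (eq_bigr (fun=> p%:Z - 1)) => [|x _]; last exact: defect_in.
have p2 := prime_gt1 p_prime.
have : (0 < #|F|)%N by apply/card_gt0P; exists 0.
by rewrite sum_const_int => F_gt0 /eqP; rewrite mulf_eq0 eqz_nat (gtn_eqF F_gt0) /=; lia.
Qed.

Lemma defectN (x : F) : e (- x) = e x.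
Proof.
rewrite -mulN1r defect_scale // ?oppr_eq0 ?oner_eq0 //.
by rewrite -{1}(expn1 p) pFrobN expr1n.
Qed.

Lemma natr_inj_lt (a b : nat) :
  (a < p)%N -> (b < p)%N -> a%:R = b%:R :> F -> a = b.
Proof.
wlog le_ab : a b / (a <= b)%N => [wl lt_a lt_b E|_ lt_b E].
  by have [/wl|/ltnW/wl] := leqP a b; [apply | move=> ->].
have : (p %| b - a)%N by rewrite (dvdn_pcharf charF) natrB // E subrr.
by rewrite /dvdn modn_small; lia.
Qed.

(** Two points of the line in the image of [wp] would put a nonzero prime-field multiple of [r],
    hence [r] itself, there. So at most one lies in the image and each line sum is at most 0; over
    all [x] these sums add up to 0, so each vanishes. *)
Lemma sum_defect_line (x r : F) : ~~ in_wp r -> \sum_(m < p) e (x - m%:R * r) = 0.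
Proof.
move=> r_notin.
pose g x := \sum_(m < p) e (x - m%:R * r).
have g_le0 z : g z <= 0.
  have [m0 m0_in|none] := pickP [pred m : 'I_p | in_wp (z - m%:R * r)]; last first.
    rewrite /g; apply: sumr_le0 => m _; rewrite defect_notin //.
    by have /= -> := none m.
  rewrite /g (bigD1 m0) //= defect_in // (eq_bigr (fun=> -1)) => [|m m_neq].
    by rewrite sumr_const cardC1 card_ord -mulr_natl; lia.
  apply: defect_notin; apply: contra r_notin => m_in.
  case/existsP: m0_in => y0 /eqP Ey0; case/existsP: m_in => y /eqP Ey.
  pose t : F := m%:R - m0%:R.
  have t0 : t != 0.
    rewrite subr_eq0; apply: contra m_neq => /eqP Emm; apply/eqP/val_inj.
    exact: (natr_inj_lt (ltn_ord m) (ltn_ord m0) Emm).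
  have tp : t ^+ p = t by have := pFrobB 1 m%:R m0%:R; rewrite !pFrob_nat expn1.
  apply/existsP; exists (t^-1 * (y0 - y)).
  rewrite wpM ?exprVn ?tp // wpD wpN Ey Ey0; apply/eqP.
  by rewrite (_ : _ - _ - _ = t * r) ?mulKf // /t; ring.
have g_sum : \sum_z - g z = 0.
  rewrite sumrN exchange_big /= big1 ?oppr0 // => m _.
  rewrite -[RHS]sum_defect [RHS](reindex_inj (addIr (- (m%:R * r)))) //.
have g_ge0 z : true -> 0 <= - g z by rewrite oppr_ge0.
have := psumr_eq0P g_ge0 g_sum (i := x) isT.
by move/eqP; rewrite oppr_eq0 => /eqP.
Qed.

(** * Weyl differencing *)

(** [b = 1] gives the right side of the curve equation, [b = 0] the form without linear term. *)
Definition herm (i : nat) (b x : F) : F := x ^+ (p ^ i).+1 + b * x.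

(** After x = y + z the cross terms are y^(p^i) z and y z^(p^i). Raising the second to the power
    p^i, which [e] ignores, makes their sum linear in y^(p^i), and orthogonality in [y] leaves only
    the radical. *)
Lemma sum_defect_herm_diff (i : nat) (b : F) :
  \sum_x \sum_y e (herm i b x - herm i b y) =
  #|F|%:Z * \sum_(z | z ^+ (p ^ (i + i)) == - z) e (herm i b z).
Proof.
rewrite exchange_big /=.
under eq_bigr => y _ do rewrite (reindex_inj (addrI y)) /=.
rewrite exchange_big big_distrr big_mkcond [RHS]big_mkcond /=.
apply: eq_bigr => z _.
rewrite -[RHS](_ : (if z ^+ (p ^ (i + i)) + z == 0 then #|F|%:Z * e (herm i b z) else 0) = _); last first.
  by rewrite addr_eq0.
rewrite -(sum_defect_affine _ _ i); apply: eq_bigr => y _.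
have -> : herm i b z + y ^+ (p ^ i) * (z ^+ (p ^ (i + i)) + z) =
          herm i b z + y ^+ (p ^ i) * z + (y * z ^+ (p ^ i)) ^+ (p ^ i).
  by rewrite expnD exprM exprMn; ring.
rewrite defect_frob; congr e; rewrite /herm !exprS pFrobD; ring.
Qed.

(** As [e] combines several characters, the square is not itself a double sum of [e (f x - f y)].
    The shifted sums [G s] repair this: convolution evaluates the sum of their squares, and [G]
    equals [G 0] on the image of [wp], whose fibres have at most [p] elements. *)
Lemma sum_defect_herm_sqr_le (i : nat) (b : F) :
  (\sum_x e (herm i b x)) ^+ 2 <=
  (p * p.-1 * #|F| * #|[set z : F | z ^+ (p ^ (i + i)) == - z]|)%:Z.
Proof.
set f := herm i b; set W := [set z | _].
pose G s := \sum_x e (f x - s).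
have F_gt0 : 0 < #|F|%:Z by rewrite ltz_nat; apply/card_gt0P; exists 0.
have sumG : \sum_s G s ^+ 2 = #|F|%:Z * \sum_x \sum_y e (f x - f y).
  under eq_bigr => s _ do rewrite expr2 /G mulr_suml.
  rewrite exchange_big big_distrr /=; apply: eq_bigr => y _.
  under eq_bigr => s _ do rewrite mulr_sumr.
  rewrite exchange_big big_distrr /=; apply: eq_bigr => x _.
  by rewrite sum_defect_conv -[e (f y - _)]defectN opprB.
have G_wp y : G (wp y) = G 0.
  by apply: eq_bigr => x _; rewrite -wpN defect_wp subr0.
have le1 : #|F|%:Z * G 0 ^+ 2 <= p%:Z * \sum_s G s ^+ 2.
  have -> : #|F|%:Z * G 0 ^+ 2 = \sum_y G (wp y) ^+ 2.
    rewrite (eq_bigr (fun=> G 0 ^+ 2)) => [|y _]; last by rewrite G_wp.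
    by rewrite sum_const_int.
  rewrite -(sum_wp_fiber (fun s => G s ^+ 2)) mulr_sumr; apply: ler_sum => s _.
  by rewrite ler_wpM2r ?sqr_ge0 // lez_nat card_wp_fiber_le.
have -> : \sum_x e (f x) = G 0 by apply: eq_bigr => x _; rewrite subr0.
rewrite -(ler_pM2l F_gt0); apply: le_trans le1 _.
rewrite sumG sum_defect_herm_diff.
have le2 : \sum_(z | z ^+ (p ^ (i + i)) == - z) e (herm i b z) <= p.-1%:Z * #|W|%:Z.
  rewrite mulrC -natz mulr_natl -sumr_const.
  rewrite [leRHS](eq_bigl (fun z => z ^+ (p ^ (i + i)) == - z)) => [|z]; last by rewrite inE.
  by apply: ler_sum => z _; apply: le_trans (defect_le _) _; lia.
apply: (@le_trans _ _ (p%:Z * (#|F|%:Z * (#|F|%:Z * (p.-1%:Z * #|W|%:Z))))).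
  by rewrite ler_wpM2l // ler_pM2l // ler_pM2l.
by rewrite !PoszM le_eqVlt; apply/orP; left; apply/eqP; ring.
Qed.
Lemma pFrob_fix (i : nat) (t : F) : t ^+ p = t -> t ^+ (p ^ i) = t.
Proof. by move=> tp; elim: i => [|i IH]; rewrite ?expr1 // expnSr exprM IH. Qed.

(** Here [c *+ n] is the trace of [c]. If y^p = y + c then y^(p^i) = y + i c, and i = n gives n c =
    0; conversely the same iteration modulo X^p - X - c shows that this polynomial divides X^(p^n) -
    X. *)
Lemma in_wp_fixE (c : F) : c ^+ p = c -> in_wp c = (c *+ n == 0).
Proof.
move=> cp; apply/idP/idP => [/existsP[y /eqP Ey] | /eqP cn].
  have yi i : y ^+ (p ^ i) = y + c *+ i.
    elim: i => [|i IH]; first by rewrite expr1 addr0.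
    rewrite expnS exprM (_ : y ^+ p = y + c); last by rewrite -Ey /wp; ring.
    by rewrite pFrobD IH pFrob_fix // mulrSr addrA.
  by have := yi n; rewrite -cardF expf_card => /eqP; rewrite eq_sym -subr_eq0 addrC addKr.
have p2 := prime_gt1 p_prime.
have charFX : p \in [pchar {poly F}] by rewrite pchar_poly.
pose g : {poly F} := 'X^p + (- 'X - c%:P).
have sz : size g = p.+1.
  rewrite /g size_polyDl ?size_polyXn // -opprD size_polyN.
  by rewrite size_XaddC.
have g_dvd i : g %| 'X^(p ^ i) - ('X + (c *+ i)%:P).
  elim: i => [|i IH]; first by rewrite expr1 addr0 subrr dvdp0.
  have := dvdp_trans IH (dvdp_subX_subXX _ _ p).
  rewrite -exprM -expnSr exprDn_pchar; last by rewrite pnatE // charFX.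
  rewrite -polyC_exp (_ : (c *+ i) ^+ p = c *+ i); last first.
    by rewrite -mulr_natl exprMn cp; have := pFrob_nat 1 i; rewrite expn1 => ->.
  move=> dvd1; rewrite -(subrKA ('X^p + (c *+ i)%:P) 'X^(p ^ i.+1)) dvdp_add //.
  by rewrite (_ : _ - _ = g) // /g mulrSr polyCD; ring.
have := g_dvd n; rewrite cn polyC0 addr0 -cardF => /card_roots_dvd.
rewrite sz /= => card_g.
have /card_gt0P[y] : (0 < #|[set x | root g x]|)%N by rewrite card_g prime_gt0.
rewrite inE rootE /g !hornerE => /eqP Ey; apply/existsP; exists y.
by rewrite /wp -subr_eq0; apply/eqP; exact: Ey.
Qed.

(** * Exact evaluation over the field with p^(4lj) elements *)

Section MaximalField.

Variables (l j : nat) (l_gt0 : (0 < l)%N) (odd_p : odd p).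
Hypothesis Dn : n = (4 * (l * j))%N.
Local Notation q := (p ^ l)%N.

Let q_gt1 : (1 < q)%N.
Proof. by rewrite -(exp1n l) ltn_exp2r ?prime_gt1. Qed.

Let two_neq0 : 2%:R != 0 :> F.
Proof.
rewrite -(dvdn_pcharf charF) gtnNdvd // ltn_neqAle prime_gt1 // andbT.
by apply: contraTneq odd_p => <-.
Qed.

Lemma dvdn_subX_subXX (a b i : nat) : (a - b %| a ^ i - b ^ i)%N.
Proof. by rewrite subn_exp dvdn_mulr. Qed.

(** The factor [q.+1] puts the (q+1)-st roots of unity into [F]; the factor [q.-1] makes nonzero
    prime-field elements (q+1)-st powers. *)
Lemma card_pred_max : exists c, #|F|.-1 = (q.+1 * (q.-1 * c))%N.
Proof.
have [c Ec] : exists c, #|F|.-1 = (c * (q ^ 2 - 1))%N.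
  apply/dvdnP; rewrite cardF Dn -subn1 (_ : 4 * (l * j) = l * 2 * (2 * j))%N; last by lia.
  by rewrite expnM (expnM p l 2) -[X in (_ %| _ - X)%N](exp1n (2 * j)) dvdn_subX_subXX.
exists c; rewrite Ec (_ : q ^ 2 - 1 = q.+1 * q.-1)%N; first by lia.
by rewrite -(exp1n 2) subn_sqr mulnC addn1 subn1.
Qed.

Lemma hermitian_norm_surj (t : F) : t ^+ p = t -> t != 0 -> exists a, a ^+ q.+1 = t.
Proof.
move=> tp t0; have [c Ec] := card_pred_max.
have /card_gt0P[a] : (0 < #|[set a : F | a ^+ q.+1 == t]|)%N.
  rewrite card_roots_XnsubC // Ec ?dvdn_mulr // mulKn // exprM.
  rewrite (_ : t ^+ q.-1 = 1) ?expr1n //; apply: (mulfI t0).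
  by rewrite -exprS prednK ?(ltnW q_gt1) // pFrob_fix // mulr1.
by rewrite inE => /eqP at_; exists a.
Qed.

Definition norm_sum (r : F) : int := \sum_x e (x ^+ q.+1 - r).

Lemma norm_sum_scale (t r : F) : t ^+ p = t -> t != 0 -> norm_sum (t * r) = norm_sum r.
Proof.
move=> tp t0; have [a Ea] := hermitian_norm_surj tp t0.
have a0 : a != 0 by apply: contra t0 => /eqP a0; rewrite -Ea a0 expr0n.
rewrite /norm_sum (reindex_inj (mulfI a0)); apply: eq_bigr => x _.
by rewrite exprMn Ea -mulrBr defect_scale.
Qed.

(** For [r] outside the image of [wp], the values [norm_sum (m r)] add up to 0 along the line, and
    those with m nonzero all equal [norm_sum r] by scaling. *)
Lemma norm_sumE (r : F) : (p%:Z - 1) * norm_sum r = norm_sum 0 * e r.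
Proof.
have [r_in|r_notin] := boolP (in_wp r).
  rewrite (defect_in r_in) mulrC; congr (_ * _).
  case/existsP: r_in => y /eqP <-; apply: eq_bigr => x _.
  by rewrite -wpN defect_wp subr0.
have p_gt0 := prime_gt0 p_prime.
have : \sum_(m < p) norm_sum (m%:R * r) = 0.
  rewrite exchange_big big1 // => x _; exact: sum_defect_line.
rewrite (bigD1 (Ordinal p_gt0)) //= mul0r (eq_bigr (fun=> norm_sum r)) => [|m m0].
  rewrite sumr_const cardC1 card_ord -mulr_natl natz -subn1 -subzn //.
  by move/eqP; rewrite (defect_notin r_notin) addr_eq0 => /eqP ->; ring.
rewrite norm_sum_scale //; first by have := pFrob_nat 1 m; rewrite expn1.
apply: contra m0 => /eqP m0; apply/eqP/val_inj.
exact: (natr_inj_lt (ltn_ord m) p_gt0 m0).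
Qed.

(** With Q = q^2 odd, X^Q + X divides X^(Q^2) - X, hence X^#F - X, because #F = (Q^2)^j. So all its
    roots lie in [F]. *)
Lemma card_radical : #|[set z : F | z ^+ (p ^ (l + l)) == - z]| = (q ^ 2)%N.
Proof.
set Q := (p ^ (l + l))%N.
have EQ : Q = (q ^ 2)%N by rewrite /Q addnn -muln2 expnM.
have oddQ : odd Q by rewrite /Q oddX odd_p orbT.
have Q_gt1 : (1 < Q)%N by rewrite EQ -(exp1n 2) ltn_exp2r.
pose g : {poly F} := 'X^Q - - 'X.
have sz : size g = Q.+1 by rewrite /g opprK size_polyDl ?size_polyXn // size_polyX.
rewrite -EQ -[RHS]/(Q.+1.-1) -sz -card_roots_dvd.
  by apply: eq_card => z; rewrite !inE rootE /g !hornerE opprK addr_eq0.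
have g_dvd i : g %| 'X^((Q ^ 2) ^ i) - 'X.
  elim: i => [|i IH]; first by rewrite expr1 subrr dvdp0.
  have := dvdp_subX_subXX 'X^((Q ^ 2) ^ i) 'X (Q ^ 2).
  rewrite -exprM -expnSr => /(dvdp_trans IH) dvd1.
  rewrite -(subrKA 'X^(Q ^ 2) 'X^((Q ^ 2) ^ i.+1)) dvdp_add // expnS expn1.
  have dvd2 : g %| 'X^(Q * Q) + 'X^Q.
    have := dvdp_subX_subXX 'X^Q (- 'X) Q.
    by rewrite -exprM (exprNn 'X Q) -signr_odd oddQ expr1 mulN1r (opprK 'X^Q).
  have -> : 'X^(Q * Q) - 'X = 'X^(Q * Q) + 'X^Q - g :> {poly F} by rewrite /g; ring.
  by rewrite dvdp_sub ?dvdpp.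
by have := g_dvd j; rewrite EQ -!expnM cardF Dn; congr (_ %| 'X^(p ^ _) - _); lia.
Qed.

(** The value w = z^(q+1) satisfies w^q = -w, so [e] takes the same value at 2w = w + w as at w +
    w^q = 0; the scalar 2 does not change [e]. *)
Lemma defect_radical (z : F) : z ^+ (p ^ (l + l)) = - z -> e (herm l 0 z) = p%:Z - 1.
Proof.
move=> Ez; rewrite -(@defect_scale 2%:R) //; last by have := pFrob_nat 1 2; rewrite expn1.
rewrite mulr_natl mulr2n -[e _](defect_frob _ _ l) -(defect_in in_wp0); congr e.
rewrite /herm mul0r addr0 exprS exprMn -exprM -expnD Ez; ring.
Qed.

(** By [norm_sumE], p - 1 times the double sum of [e (f x - f y)] is [norm_sum 0] squared, while
    differencing evaluates the double sum, [e] being p - 1 on the whole radical. *)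
Lemma norm_sum0_sqr : norm_sum 0 ^+ 2 = ((p%:Z - 1) * (q ^ (2 * j).+1)%:Z) ^+ 2.
Proof.
have f0 x : herm l 0 x = x ^+ q.+1 by rewrite /herm mul0r addr0.
have := sum_defect_herm_diff l 0.
rewrite [X in _ = _ * X](eq_bigr (fun=> p%:Z - 1)) => [|z /eqP]; last exact: defect_radical.
rewrite sumr_const (_ : #|_| = (q ^ 2)%N); last first.
  by rewrite -card_radical; apply: eq_card => z; rewrite inE.
move=> E1; have : (p%:Z - 1) * \sum_x \sum_y e (herm l 0 x - herm l 0 y) = norm_sum 0 ^+ 2.
  rewrite exchange_big big_distrr expr2 {2}/norm_sum big_distrr /=.
  apply: eq_bigr => y _; rewrite subr0 -f0 -norm_sumE; congr (_ * _).
  by apply: eq_bigr => x _; rewrite f0.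
rewrite {}E1 => <-; rewrite cardF Dn -mulr_natl natz.
have -> : (p ^ (4 * (l * j)))%N = (q ^ (2 * j) * q ^ (2 * j))%N.
  by rewrite -expnD -expnM; congr (_ ^ _)%N; lia.
by rewrite (expnS q (2 * j)) (expnS q 1) expn1 !PoszM; ring.
Qed.

(* [x] and [a * x] have the same norm whenever [a ^+ q.+1 = 1], so every
   [norm_sum r] is congruent modulo [q.+1] to its term at 0; this fixes the sign. *)
Lemma norm_sum0 : norm_sum 0 = - ((p%:Z - 1) * (q ^ (2 * j).+1)%:Z).
Proof.
have p2 := prime_gt1 p_prime.
have := norm_sum0_sqr => /eqP; rewrite eqf_sqr => /orP[] /eqP // E0.
have [r r_notin] := exists_notin_wp.
have Er : norm_sum r = - (q ^ (2 * j).+1)%:Z.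
  have := norm_sumE r; rewrite E0 (defect_notin r_notin).
  rewrite mulrN1 -mulrN => /mulfI; apply; lia.
have [c Ec] := card_pred_max.
have := @sum_nonzero_exp q.+1 (fun x => e (x - r)) isT.
rewrite Ec dvdn_mulr // => /(_ isT).
move: Er; rewrite /norm_sum (bigD1 0) //= expr0n sub0r defectN (defect_notin r_notin).
move/(canRL (addKr _)) => ->; rewrite opprK => dvd1.
have : (q.+1%:Z %| q%:Z ^+ (2 * j).+1 - (-1) ^+ (2 * j).+1)%Z.
  by rewrite subrXX (_ : q%:Z - -1 = q.+1%:Z) ?dvdz_mulr //; lia.
rewrite -(signr_odd _ (2 * j).+1) oddS oddM expr1 opprK -(natz q) -natrX natz => dvd2.
have := rpredD dvd1 dvd2; rewrite [X in X \in _](_ : _ = 2%:Z) => [dvd3|]; last by ring.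
have : (q.+1 %| 2)%N := dvd3.
by move/dvdn_leq => /(_ isT); lia.
Qed.

Lemma sum_defect_curve :
  \sum_x e (x ^+ q.+1 + x) = if (p %| l * j)%N then - ((p%:Z - 1) * (q ^ (2 * j).+1)%:Z)
                             else (q ^ (2 * j).+1)%:Z.
Proof.
have p2 := prime_gt1 p_prime.
have [h [h2 hp h0]] : exists h : F, [/\ h + h = 1, h ^+ p = h & h != 0].
  exists 2%:R^-1; split; last by rewrite invr_eq0.
    by rewrite -mulr2n -(mulr_natl 2%:R^-1) divff.
  by rewrite exprVn; have := pFrob_nat 1 2; rewrite expn1 => ->.
pose c : F := h ^+ 2.
have cp : c ^+ p = c by rewrite /c exprAC hp.
(* Replacing x by x - 1/2 gives x^(q+1) - 1/4 + (h x - (h x)^q) with h = 1/2, and [e] ignores the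
   bracket. *)
have -> : \sum_x e (x ^+ q.+1 + x) = norm_sum c.
  rewrite (reindex_inj (addIr (- h))); apply: eq_bigr => x _.
  rewrite (_ : _ + _ = x ^+ q.+1 - c - (h * x) ^+ q + h * x); last first.
    rewrite !exprS pFrobB exprMn (pFrob_fix l hp) /c; move: (x ^+ q) => xq; apply/eqP; rewrite -subr_eq0.
    rewrite (_ : _ - _ = (x - h) * (1 - (h + h))); last by ring.
    by rewrite h2 subrr mulr0.
  by rewrite -(defect_frob _ (h * x) l) subrK.
(* The trace of c = 1/4 is n c = l j. *)
have in_c : in_wp c = (p %| l * j)%N.
  rewrite in_wp_fixE // -mulr_natr mulf_eq0 expf_eq0 (negPf h0) andbF /=.
  rewrite -(dvdn_pcharf charF) Dn Euclid_dvdM // (_ : 4 = 2 ^ 2)%N // Euclid_dvdX //.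
  by rewrite (dvdn_pcharf charF) (negPf two_neq0).
have := norm_sumE c; rewrite norm_sum0 mulNr -mulrA -mulrN => /mulfI Ec.
rewrite Ec; last by lia.
rewrite -in_c; case: ifPn => [/defect_in->|/defect_notin->]; ring.
Qed.

End MaximalField.

(** * The upper bound when k does not divide m *)

Lemma pFrob_fix_gcdn (a b : nat) (u : F) :
  (0 < a)%N -> u ^+ (p ^ a) = u -> u ^+ (p ^ b) = u -> u ^+ (p ^ gcdn a b) = u.
Proof.
move=> a_gt0 ua ub.
have iter_fix (c d : nat) : u ^+ (p ^ c) = u -> u ^+ (p ^ (d * c)) = u.
  by move=> uc; elim: d => [|d IH]; rewrite ?expr1 // mulSn expnD exprM uc.
have [s t E _] := egcdnP b a_gt0.
have := iter_fix a s ua; rewrite E expnD exprM (iter_fix b t ub).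
by [].
Qed.

(** Quotients of radical elements by a fixed nonzero one [w] lie in the field with p^d elements, d =
    gcd(2k, n). If d = 2k, write n = 2kr; iterating w^(p^(2k)) = -w forces r even, so k divides m.
    Hence d is a proper divisor of 2k, and d <= k. *)
Lemma card_radical_le (k m : nat) : odd p -> n = (4 * m)%N -> (1 < k)%N -> ~~ (k %| m)%N ->
  (#|[set z : F | z ^+ (p ^ (k + k)) == - z]| <= p ^ k)%N.
Proof.
move=> odd_p Dn k_gt1 k_ndvd; set W := [set z | _].
have p2 := prime_gt1 p_prime; have k_gt0 := ltnW k_gt1.
have [w /andP[w_in w0]|W0] := pickP [pred w | (w \in W) && (w != 0)]; last first.
  apply: (@leq_trans 1); last by rewrite expn_gt0 prime_gt0.
  rewrite -(cards1 (0 : F)); apply/subset_leq_card/subsetP => z z_in.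
  by have := W0 z; rewrite /= z_in inE /= => /negbFE.
have Fn (z : F) : z ^+ (p ^ n) = z by rewrite -cardF expf_card.
set d := gcdn (k + k) n.
have d_dvd : (d %| k + k)%N := dvdn_gcdl _ _.
have [d_eq|d_neq] := eqVneq d (k + k)%N.
  have : (k + k %| n)%N by rewrite -d_eq dvdn_gcdr.
  case/dvdnP=> r Er; case/negP: k_ndvd.
  have wi i : w ^+ (p ^ (i * (k + k))) = (-1) ^+ i * w.
    elim: i => [|i IH]; first by rewrite expr1 mul1r.
    move: w_in; rewrite inE => /eqP Ew.
    by rewrite mulSn expnD exprM Ew pFrobN IH exprS mulN1r mulNr.
  have := wi r; rewrite -Er Fn -signr_odd.
  have [odd_r|even_r] := boolP (odd r).
    rewrite expr1 mulN1r => /eqP; rewrite -subr_eq0 opprK -mulr2n -mulr_natl mulf_eq0 (negPf w0) orbF.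
    rewrite -(dvdn_pcharf charF) dvdn_prime2 // => /eqP E2.
    by rewrite E2 in odd_p.
  move=> _; apply/dvdnP; exists (r./2).
  by have := odd_double_half r; rewrite (negPf even_r); lia.
have le_dk : (d <= k)%N.
  case/dvdnP: d_dvd => c Ec; case: c Ec => [|[|c]] Ec; lia.
apply: (@leq_trans (p ^ d)); last by rewrite leq_exp2l.
have d_gt0 : (0 < d)%N by rewrite gcdn_gt0 addn_gt0 k_gt0.
have Pd_gt1 : (1 < p ^ d)%N by rewrite -(exp1n d) ltn_exp2r.
have sz : size ('X^(p ^ d) - 'X : {poly F}) = (p ^ d).+1.
  by rewrite size_polyDl ?size_polyXn // size_polyN size_polyX.
have g_neq0 : 'X^(p ^ d) - 'X != 0 :> {poly F} by rewrite -size_poly_eq0 sz.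
rewrite -ltnS -sz cardE.
rewrite -(size_map (fun z => z / w)); apply: max_poly_roots => //.
  apply/allP => _ /mapP[z z_in ->]; rewrite mem_enum inE in z_in.
  move: w_in; rewrite inE => /eqP Ew.
  rewrite rootE !hornerE subr_eq0 pFrob_fix_gcdn ?addn_gt0 ?k_gt0 //.
  by rewrite expr_div_n Ew (eqP z_in) invrN mulrNN.
rewrite map_inj_uniq ?enum_uniq //; apply: mulIf; by rewrite invr_eq0.
Qed.

Lemma sum_defect_curve_sqr_lt (k m : nat) :
  odd p -> n = (4 * m)%N -> (1 < k)%N -> ~~ (k %| m)%N ->
  (\sum_x e (x ^+ (p ^ k).+1 + x)) ^+ 2 < (p ^ k * p ^ (2 * m))%:Z ^+ 2.
Proof.
move=> odd_p Dn k_gt1 k_ndvd; have p2 := prime_gt1 p_prime.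
have := sum_defect_herm_sqr_le k 1.
under eq_bigr => x _ do rewrite /herm mul1r.
move/le_lt_trans; apply.
rewrite -[X in _ < X ^+ 2]natz -natrX natz ltz_nat expnMn.
apply: (@leq_ltn_trans (p * p.-1 * (p ^ (2 * m)) ^ 2 * p ^ k)).
  rewrite {1}cardF Dn (_ : 4 * m = 2 * m * 2)%N; last by lia.
  by rewrite -expnM leq_mul // (card_radical_le odd_p Dn).
(* p (p - 1) < p^2 <= p^k, where k > 1 enters. *)
have pk2 : (p * p.-1 * p ^ k < (p ^ k) ^ 2)%N.
  rewrite -expnM mulnC [X in (_ < _ ^ X)%N](_ : _ = k + k)%N; last by lia.
  rewrite expnD ltn_pmul2l ?expn_gt0 ?prime_gt0 //.
  apply: (@leq_trans (p ^ 2)); last by rewrite leq_exp2l.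
  by rewrite expnS expn1 ltn_pmul2l //; lia.
by rewrite mulnAC ltn_pmul2r // ?expn_gt0 ?prime_gt0.
Qed.
End FiniteField.

(** Points are counted by their x-coordinate; the point at infinity cancels the final [- 1]. *)
Lemma curve_card_defect (F : finFieldType) (p k n : nat) :
  #|F| = (p ^ n)%N ->
  (curve_card p k F)%:Z - (p ^ n)%:Z - 1 = \sum_(x : F) wp_defect p (x ^+ (p ^ k).+1 + x).
Proof.
move=> cardF; rewrite /wp_defect sumrB sum_const_int cardF mulr1.
have -> : curve_card p k F =
    (\sum_(x : F) #|[set y : F | wp p y == (x ^+ (p ^ k).+1 + x)%R]|).+1%N.
  rewrite /curve_card; congr _.+1; rewrite -sum1_card.
  rewrite (partition_big (fun P : F * F => P.1) predT) //=; apply: eq_bigr => x _.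
  rewrite sum1_card -[RHS](card_imset _ (can_inj (f := pair x) (g := snd) (fun=> erefl))).
  apply: eq_card => -[x' y]; rewrite -topredE /= inE /=; apply/andP/imsetP => [[Exy /eqP Ex]|[y']].
    by exists y; rewrite ?Ex // inE -Ex.
  by rewrite inE => Ey [-> ->].
rewrite -addn1 PoszD (big_morph Posz PoszD (erefl _)) /=; ring.
Qed.

(** * Point counts and L-polynomials *)

Lemma GFpS_card (p : nat) (pr_p : prime p) (n : nat) : #|GFpS pr_p n| = (p ^ n.+1)%N.
Proof. by rewrite /GFpS; case: (pPrimePowerField _ _). Qed.

(** The predecessor undoes the shift in [GFpS]; the value is meaningful only for positive [n]. *)
Definition excess (p : nat) (pr_p : prime p) (k n : nat) : int :=
  (curve_card p k (GFpS pr_p n.-1))%:Z - (p ^ n)%:Z - 1.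

Lemma log_coef_excess (p : nat) (pr_p : prime p) (k n : nat) :
  n.+1%:R * log_coef pr_p k n.+1 = (excess pr_p k n.+1)%:~R.
Proof.
rewrite /log_coef /excess [n.+1.-1]/= mulrC divfK ?pnatr_eq0 //.
by rewrite !rmorphB /= !pmulrn.
Qed.

Lemma excess_max (p : nat) (pr_p : prime p) (l j : nat) :
  odd p -> (0 < l)%N -> (0 < j)%N ->
  excess pr_p l (4 * (l * j)) =
  if (p %| l * j)%N then - ((p%:Z - 1) * ((p ^ l) ^ (2 * j).+1)%:Z)
  else ((p ^ l) ^ (2 * j).+1)%:Z.
Proof.
move=> odd_p l_gt0 j_gt0; set n := (4 * (l * j))%N.
have n_gt0 : (0 < n)%N by rewrite !muln_gt0 l_gt0.
have cardF : #|GFpS pr_p n.-1| = (p ^ n)%N by rewrite GFpS_card prednK.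
rewrite /excess (curve_card_defect _ cardF).
exact: (sum_defect_curve pr_p cardF).
Qed.

Lemma excess_sqr_lt (p : nat) (pr_p : prime p) (k m : nat) :
  odd p -> (0 < m)%N -> (1 < k)%N -> ~~ (k %| m)%N ->
  excess pr_p k (4 * m) ^+ 2 < (p ^ k * p ^ (2 * m))%:Z ^+ 2.
Proof.
move=> odd_p m_gt0 k_gt1 k_ndvd; set n := (4 * m)%N.
have n_gt0 : (0 < n)%N by rewrite muln_gt0.
have cardF : #|GFpS pr_p n.-1| = (p ^ n)%N by rewrite GFpS_card prednK.
rewrite /excess (curve_card_defect _ cardF).
exact: (sum_defect_curve_sqr_lt pr_p cardF).
Qed.

(** * Exponential series and Newton's identities *)

Section ExpCoef.

Variables (c : nat -> rat) (c0 : c 0%N = 0).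

(** One polynomial and one number of terms can serve all coefficients up to a bound: since
    [c 0 = 0], the [j]-th power has no terms below degree [j]. *)
Lemma exp_coefE (P : {poly rat}) (J m : nat) :
  (m < J)%N -> (forall i, (i <= m)%N -> P`_i = c i) ->
  exp_coef c m = (\sum_(j < J) (j`!%:R)^-1 *: P ^+ j)`_m.
Proof.
move=> lt_mJ EP; rewrite /exp_coef.
set A := \poly_(i < _) _.
have EA i : (i <= m)%N -> A`_i = P`_i by move=> le_im; rewrite coef_poly ltnS le_im EP.
have Epow j i : (i <= m)%N -> (A ^+ j)`_i = (P ^+ j)`_i.
  elim: j i => [|j IH] i le_im //; rewrite !exprS !coefM; apply: eq_bigr => h _.
  have le_hi : (h <= i)%N by rewrite -ltnS.
  by rewrite EA ?IH // (leq_trans _ le_im) // leq_subr.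
have Pow0 j i : (i <= m)%N -> (i < j)%N -> (P ^+ j)`_i = 0.
  elim: j i => // j IH i le_im lt_ij; rewrite exprS coefM big1 // => h _.
  have [h0|h_gt0] := posnP h; first by rewrite h0 EP // c0 mul0r.
  rewrite IH ?mulr0 ?(leq_trans (leq_subr _ _)) //.
  have : (h <= i)%N by rewrite -ltnS.
  by lia.
rewrite !coef_sum (big_ord_widen_cond J predT (fun j => ((j`!)%:R^-1 *: A ^+ j)`_m)) //.
rewrite [LHS]big_mkcond; apply: eq_bigr => j _; rewrite !coefZ.
by case: ltnP => [_|lt_mj]; rewrite ?Epow // Pow0 ?mulr0.
Qed.

Lemma exp_coef0 : exp_coef c 0 = 1.
Proof. by rewrite /exp_coef big_ord1 expr0 invr1 scale1r coef1. Qed.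

(** Coefficientwise form of (exp f)' = f' exp f. *)
Lemma exp_coef_rec (n : nat) :
  n.+1%:R * exp_coef c n.+1 =
  \sum_(i < n.+1) i.+1%:R * c i.+1 * exp_coef c (n - i).
Proof.
pose P := \poly_(i < n.+2) c i.
have EP i : (i <= n.+1)%N -> P`_i = c i by move=> le_in; rewrite coef_poly ltnS le_in.
rewrite (exp_coefE (ltnSn n.+1) EP) mulr_natl -coef_deriv.
have -> : (\sum_(j < n.+2) (j`!%:R)^-1 *: P ^+ j)^`() =
          P^`() * \sum_(j < n.+1) (j`!%:R)^-1 *: P ^+ j.
  rewrite big_ord_recl expr0 derivD derivZ -polyC1 derivC scaler0 add0r.
  rewrite raddf_sum mulr_sumr; apply: eq_bigr => j _.
  rewrite /= derivZ deriv_exp -scalerAr /bump leq0n add1n /= -scalerMnr scalerMnl; congr (_ *: _).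
  by rewrite factS natrM invfM -mulr_natl mulVKf ?pnatr_eq0.
rewrite coefM; apply: eq_bigr => i _.
have le_in : (i <= n)%N by rewrite -ltnS.
rewrite coef_deriv EP ?ltnS // mulr_natl -exp_coefE ?ltnS ?leq_subr // => h le_h.
by apply: EP; lia.
Qed.

End ExpCoef.

(** This is the logarithmic derivative of [Q] modulo X^(n+1): [T a] is the geometric series of a /
    (1 - aX) cut off after degree [n]. *)
Lemma newton_prod (C : fieldType) (s : seq C) (n : nat)
    (Q := \prod_(a <- s) (1 - a *: 'X)) :
  n.+1%:R * Q`_n.+1 = - \sum_(i < n.+1) (\sum_(a <- s) a ^+ i.+1) * Q`_(n - i).
Proof.
pose T a : {poly C} := \sum_(i < n.+1) a ^+ i.+1 *: 'X^i.
have dvd_T : 'X^(n.+1) %| Q^`() + Q * \sum_(a <- s) T a.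
  rewrite /Q; elim: s {Q} => [|a s IH]; first by rewrite !big_nil derivC mulr0 addr0 dvdp0.
  rewrite !big_cons; set R := \prod_(_ <- s) _ in IH *; set S := \sum_(_ <- s) _ in IH *.
  have ET : (1 - a *: 'X) * T a = a%:P - a ^+ n.+2 *: 'X^(n.+1).
    rewrite mulr_sumr (eq_bigr (fun i : 'I_n.+1 => a ^+ i.+1 *: 'X^i - a ^+ i.+2 *: 'X^(i.+1))).
      rewrite -(big_mkord predT (fun i => a ^+ i.+1 *: 'X^i - a ^+ i.+2 *: 'X^(i.+1))).
      rewrite -[LHS]opprK -sumrN (eq_bigr (fun i => a ^+ i.+2 *: 'X^(i.+1) - a ^+ i.+1 *: 'X^i)).
        by rewrite telescope_sumr // opprB expr1 expr0 alg_polyC.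
      by move=> i _; rewrite opprB.
    move=> i _; rewrite mulrBl mul1r -scalerAl -scalerAr scalerA -exprS -exprS //.
  rewrite derivM derivB -polyC1 derivC derivZ derivX sub0r polyC1.
  have -> : - a%:A * R + (1 - a *: 'X) * R^`() + (1 - a *: 'X) * R * (T a + S) =
            (1 - a *: 'X) * (R^`() + R * S) - a ^+ n.+2 *: 'X^(n.+1) * R.
    by rewrite [X in _ + X]mulrDr [_ * R * T a]mulrAC ET alg_polyC; ring.
  apply: dvdp_sub; first exact: dvdp_mull.
  by rewrite -scalerAl -mul_polyC mulrCA dvdp_mulr.
have : (Q^`() + Q * \sum_(a <- s) T a)`_n = 0.
  by case/dvdpP: dvd_T => q ->; rewrite coefMXn ltnSn.
rewrite mulr_natl -coef_deriv coefD => /eqP; rewrite addr_eq0 => /eqP ->.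
congr (- _); rewrite mulrC coefM; apply: eq_bigr => i _; congr (_ * _).
rewrite coef_sum; apply: eq_bigr => a _; rewrite coef_sum (bigD1 i) //= coefZ coefXn eqxx mulr1.
by rewrite big1 ?addr0 // => h h_neq; rewrite coefZ coefXn eq_sym (negPf (h_neq : (h : nat) != i)) mulr0.
Qed.

(** [s] lists the reciprocal roots with multiplicity. Newton's identities and the recursion of the
    exponential have the same shape and constant term 1, so induction identifies the power sums. *)
Lemma exp_poly_roots (c : nat -> rat) (L : {poly rat}) (C : numClosedFieldType)
    (LC := map_poly (ratr : rat -> C) L) :
  c 0%N = 0 -> (forall n, L`_n = exp_coef c n) ->
  exists s : seq C,
    (forall n, \sum_(a <- s) a ^+ n.+1 = - ratr (n.+1%:R * c n.+1)) /\
    (forall a, a \in s = (a != 0) && root LC a^-1).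
Proof.
move=> c0 EL.
have coefLC n : LC`_n = ratr L`_n by exact: coef_map.
have LC0 : LC`_0 = 1 by rewrite coefLC EL exp_coef0 /= rmorph1.
have LC_root0 : ~~ root LC 0 by rewrite rootE horner_coef0 LC0 oner_eq0.
have LC_neq0 : LC != 0 by apply: contraNneq LC_root0 => ->; rewrite root0.
have [r Dr] := closed_field_poly_normal LC.
have r_root z : z \in r = root LC z.
  by rewrite Dr rootZ ?lead_coef_eq0 // root_prod_XsubC.
have r_neq0 z : z \in r -> z != 0.
  by rewrite r_root; apply: contraTneq => ->.
pose s := [seq z^-1 | z <- r]; exists s.
have EQ : LC = \prod_(a <- s) (1 - a *: 'X).
  have [d Ed] : exists d, LC = d *: \prod_(a <- s) (1 - a *: 'X).
    exists (lead_coef LC * \prod_(z <- r) - z).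
    rewrite {1}Dr -scalerA; congr (_ *: _).
    rewrite /s big_map -scaler_prod !big_seq; apply: eq_bigr => z /r_neq0 z0.
    by rewrite scalerBr scalerA mulNr mulfV // !scaleNr scale1r opprK addrC alg_polyC.
  rewrite Ed (_ : d = 1) ?scale1r //.
  have := LC0; rewrite Ed coefZ -horner_coef0 horner_prod big1 ?mulr1 // => a _.
  by rewrite !hornerE ?mulr0 ?subr0.
split; last first.
  move=> a; apply/mapP/andP => [[z z_r ->]|[a0 a_root]].
    by rewrite invr_eq0 r_neq0 // invrK -r_root.
  by exists a^-1; rewrite ?invrK // r_root.
pose d i := \sum_(a <- s) a ^+ i.+1 + ratr (i.+1%:R * c i.+1).
have d_conv n : \sum_(i < n.+1) d i * LC`_(n - i) = 0.
  have E1 := newton_prod s n; rewrite -EQ in E1.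
  have := congr1 (ratr : rat -> C) (exp_coef_rec c0 n).
  rewrite -EL rmorphM /= rmorph_nat -coefLC E1 rmorph_sum /= => E2.
  under eq_bigr => i _ do rewrite mulrDl.
  rewrite big_split /= -[X in X + _]opprK E2 addrC -sumrB big1 // => i _.
  by rewrite !rmorphM /= -EL -coefLC subrr.
move=> n; apply/eqP; rewrite -addr_eq0 -/(d n); apply/eqP.
elim/ltn_ind: n => n IH; have := d_conv n.
rewrite big_ord_recr /= subnn LC0 mulr1 big1 ?add0r // => i _.
by rewrite IH ?mul0r.
Qed.

(** By linearity the weights u^(j+1) may be replaced by u w(u) for any polynomial [w]; one that
    vanishes on the other members of [s] isolates the term of [u], up to its multiplicity. *)
Lemma power_sums_root (C : numFieldType) (s : seq C) (g : {poly C}) :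
  (forall j, \sum_(u <- s) u ^+ j.+1 * g.[u] = 0) ->
  forall u, u \in s -> u != 0 -> root g u.
Proof.
move=> Hs u u_s u0.
have Hw (w : {poly C}) : \sum_(v <- s) v * w.[v] * g.[v] = 0.
  have -> : \sum_(v <- s) v * w.[v] * g.[v] =
            \sum_(i < size w) w`_i * \sum_(v <- s) v ^+ i.+1 * g.[v].
    under [RHS]eq_bigr => i _ do rewrite mulr_sumr.
    rewrite exchange_big; apply: eq_bigr => v _ /=.
    rewrite horner_coef mulr_sumr mulr_suml; apply: eq_bigr => i _.
    by rewrite exprS; ring.
  by rewrite big1 // => i _; rewrite Hs mulr0.
pose w := \prod_(v <- rem u (undup s)) ('X - v%:P).
have wu : w.[u] != 0.
  by rewrite -rootE root_prod_XsubC mem_rem_uniq ?undup_uniq // inE eqxx.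
have := Hw w; rewrite (bigID (pred1 u)) /= addrC big_seq_cond big1 ?add0r; last first.
  move=> v /andP[v_s vu]; rewrite (_ : w.[v] = 0) ?mulr0 ?mul0r //.
  by apply/rootP; rewrite root_prod_XsubC mem_rem_uniq ?undup_uniq // !inE vu mem_undup.
rewrite (eq_bigr (fun=> u * w.[u] * g.[u])) => [|v /eqP-> //].
rewrite big_const_seq iter_addr addr0 => /eqP; rewrite -mulr_natl !mulf_eq0.
rewrite (negPf u0) (negPf wu) pnatr_eq0 -leqn0 leqNgt -has_count.
by case: hasP => [_|[]] //=; exists u => //=.
Qed.

Lemma Lpoly_roots (p : nat) (pr_p : prime p) (k : nat) (L : {poly rat}) :
  is_Lpoly pr_p k L ->
  exists s : seq algC,
    (forall n, (0 < n)%N -> \sum_(a <- s) a ^+ n = - (excess pr_p k n)%:~R) /\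
    (forall a, a \in s = (a != 0) && root (map_poly ratr L) a^-1).
Proof.
move=> LP; have [//|s [s_sum s_root]] := exp_poly_roots algC (c := log_coef pr_p k) _ LP.
exists s; split=> // -[//|n] _.
by rewrite s_sum log_coef_excess ratr_int.
Qed.

Lemma sum_periodic (V : zmodType) (f : nat -> V) (p m : nat) :
  (forall i, f (i + p)%N = f i) -> \sum_(i < p) f (m + i)%N = \sum_(i < p) f i.
Proof.
move=> f_per; elim: m => [|m <-]; first exact: eq_bigr.
apply: (addIr (f m)); rewrite -[in RHS](f_per m) -(big_ord_recr p (fun i => f (m + i)%N)) /=.
rewrite big_ord_recl addn0 addrC; congr (_ + _).
by apply: eq_bigr => i _; rewrite addnS addSn.
Qed.

(** * Power sums of normalised Frobenius eigenvalues *)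

Section Divisibility.

Variables (p : nat) (pr_p : prime p) (odd_p : odd p).

(* The power sums of the numbers [a ^ (4 l) / p ^ (2 l)], for [a] ranging over
   the reciprocal roots of the L-polynomial of C_k. *)
Definition scaled_sum (l k j : nat) : rat :=
  - (excess pr_p k (4 * (l * j)))%:~R / (p ^ (2 * l * j))%:R.

Definition scaled_root (l : nat) (a : algC) : algC := a ^+ (4 * l) / (p ^ (2 * l))%:R.

Lemma scaled_root_sum (l k j : nat) (s : seq algC) :
  (forall n, (0 < n)%N -> \sum_(a <- s) a ^+ n = - (excess pr_p k n)%:~R) ->
  (0 < l)%N -> (0 < j)%N ->
  \sum_(a <- s) scaled_root l a ^+ j = ratr (scaled_sum l k j).
Proof.
move=> s_sum l_gt0 j_gt0.
rewrite fmorph_div rmorphN /= ratr_int ratr_nat -s_sum ?muln_gt0 ?l_gt0 // mulr_suml.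
apply: eq_bigr => a _; rewrite /scaled_root expr_div_n -exprM -natrX -expnM.
by rewrite mulnA.
Qed.

Lemma scaled_sum_max (l k j t : nat) :
  (0 < k)%N -> (0 < t)%N -> (l * j = k * t)%N ->
  scaled_sum l k j = if (p %| k * t)%N then (p%:R - 1) * (p ^ k)%:R else - (p ^ k)%:R.
Proof.
move=> k_gt0 t_gt0 Elj; rewrite /scaled_sum Elj excess_max //.
have -> : ((p ^ k) ^ (2 * t).+1 = p ^ k * p ^ (2 * l * j))%N.
  by rewrite expnS -expnM -mulnA Elj mulnCA.
have P0 : (p ^ (2 * l * j))%:R != 0 :> rat.
  by rewrite pnatr_eq0 -lt0n expn_gt0 prime_gt0.
apply: (mulIf P0); rewrite divfK //.
by case: ifP => _; rewrite PoszM !(rmorphN, rmorphM, rmorphB) /= -!pmulrn; ring.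
Qed.

(** Contrasts with [scaled_sum_max]: an absolute value of at least p^k reveals that [k] divides
    [l * j]. *)
Lemma scaled_sum_lt (l k j : nat) :
  (0 < l * j)%N -> (1 < k)%N -> ~~ (k %| l * j)%N -> `|scaled_sum l k j| < (p ^ k)%:R.
Proof.
move=> lj_gt0 k_gt1 k_ndvd; have lt1 := excess_sqr_lt pr_p odd_p lj_gt0 k_gt1 k_ndvd.
rewrite -(ltr_int rat) !rmorphXn /= in lt1.
rewrite -ltr_sqr ?nnegrE ?normr_ge0 ?ler0n //.
have P0 : 0 < (p ^ (2 * l * j))%:R :> rat by rewrite ltr0n expn_gt0 prime_gt0.
rewrite real_normK ?num_real // /scaled_sum expr_div_n ltr_pdivrMr ?exprn_gt0 // sqrrN.
by rewrite -exprMn -natrM -mulnA pmulrn.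
Qed.

End Divisibility.

(** * Comparison of the two curves *)

Theorem theorem27 (p : nat) (pr_p : prime p) (odd_p : odd p)
    (k l : nat) (k_gt0 : (0 < k)%N) (l_gt0 : (0 < l)%N)
    (k_ndvd_l : ~~ (k %| l)%N)
    (Lk Ll : {poly rat})
    (LkP : is_Lpoly pr_p k Lk) (LlP : is_Lpoly pr_p l Ll) :
  ~~ (Lk %| Ll).
Proof.
apply/negP => Lk_dvd.
have [sk [sk_sum sk_root]] := Lpoly_roots LkP.
have [sl [sl_sum sl_root]] := Lpoly_roots LlP.
have sub_kl a : a \in sk -> a \in sl.
  rewrite sk_root sl_root => /andP[-> ra] /=.
  by move: ra; rewrite !root_factor_theorem => /dvdp_trans -> //; rewrite dvdp_map.
have k_gt1 : (1 < k)%N.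
  by rewrite ltn_neqAle k_gt0 andbT; apply: contraNneq k_ndvd_l => <-; rewrite dvd1n.
have p2 := prime_gt1 pr_p; have p_gt0 := ltnW p2.
pose U := scaled_root p l; pose V := scaled_sum pr_p l k.
have Vmax_big : (p ^ k)%:R <= (p%:R - 1) * (p ^ k)%:R :> rat.
  by rewrite ler_peMl // lerBrDr -(natrD _ 1 1) ler_nat.
have V_big j : (0 < j)%N -> (p ^ k)%:R <= `|V j| -> (k %| l * j)%N.
  move=> j_gt0; apply: contraTT => k_ndvd.
  by rewrite -ltNge scaled_sum_lt // muln_gt0 l_gt0.
have U_sum j : (0 < j)%N -> \sum_(a <- sk) U a ^+ j = ratr (V j).
  by move=> j_gt0; apply: scaled_root_sum.
(* [g] annihilates the normalised eigenvalues of C_l, and hence those of C_k. *)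
pose g : {poly algC} := if (p %| l)%N then 'X - 1%:P else \sum_(i < p) 'X^i.
have gE u : root g u -> if (p %| l)%N then u = 1 else \sum_(i < p) u ^+ i = 0.
  rewrite /g; case: ifP => _; first by rewrite root_XsubC => /eqP.
  move/rootP; rewrite horner_sum => gu; rewrite -[RHS]gu.
  by apply: eq_bigr => i _; rewrite hornerXn.
have g_sl a : a \in sl -> root g (U a).
  move=> a_sl; have a0 : a != 0 by move: a_sl; rewrite sl_root => /andP[].
  apply: (@power_sums_root _ (map U sl)); last 2 first.
  - exact: map_f.
  - by rewrite mulf_neq0 ?expf_neq0 // invr_neq0 // pnatr_eq0 -lt0n expn_gt0 p_gt0.
  move=> j; rewrite big_map /g.
  have sumU i : (0 < i)%N -> \sum_(a <- sl) U a ^+ i = ratr (scaled_sum pr_p l l i).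
    by move=> i_gt0; apply: scaled_root_sum.
  have Vl i : (0 < i)%N -> scaled_sum pr_p l l i =
      if (p %| l * i)%N then (p%:R - 1) * (p ^ l)%:R else - (p ^ l)%:R.
    by move=> i_gt0; apply: scaled_sum_max.
  case: ifP => [p_l|/negbT p_nl].
    under eq_bigr => b _ do rewrite hornerXsubC mulrBr mulr1 -exprSr.
    by rewrite sumrB !sumU // !Vl // !dvdn_mulr // subrr.
  under eq_bigr => b _ do rewrite horner_sum mulr_sumr.
  rewrite exchange_big /=.
  pose f i : algC := if (p %| i)%N then (p%:R - 1) * (p ^ l)%:R else - (p ^ l)%:R.
  rewrite (eq_bigr (fun i : 'I_p => f (j.+1 + i)%N)) => [|i _]; last first.
    under eq_bigr => b _ do rewrite hornerXn -exprD.
    rewrite sumU // Vl // Euclid_dvdM // (negPf p_nl) /= /f.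
    by case: ifP => _; rewrite !(rmorphN, rmorphM, rmorphB, rmorph1) /= !ratr_nat.
  (* The window of [p] exponents moves to 0, ..., p - 1, where one term (p - 1) p^l meets p - 1
     terms -p^l. *)
  rewrite sum_periodic => [|i]; last by rewrite /f dvdn_addl.
  rewrite -(prednK p_gt0) big_ord_recl {1}/f dvdn0 (eq_bigr (fun=> - (p ^ l)%:R)).
    rewrite sumr_const card_ord -[X in _ + X]mulr_natl -subn1 natrB //.
    by ring.
  by move=> i _; rewrite /f lift0 gtnNdvd //; have := ltn_ord i; lia.
have sum1 : \sum_(a <- sk) 1 = (size sk)%:R :> algC.
  by rewrite big_const_seq count_predT iter_addr_0.
have Up a : a \in sk -> U a ^+ p = 1.
  move/sub_kl/g_sl/gE; case: ifP => _ [Ea]; first by rewrite Ea expr1n.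
  by apply/eqP; rewrite -subr_eq0 subrX1 Ea mulr0.
have V_size i : (0 < i)%N -> ratr (V (p * i)%N) = (size sk)%:R :> algC.
  move=> i_gt0; rewrite -U_sum ?muln_gt0 ?p_gt0 // big_seq.
  rewrite (eq_bigr (fun=> 1)) => [|a /Up Ea]; last by rewrite exprM Ea expr1n.
  by rewrite -big_seq.
(* The number of eigenvalues is read off at exponent [p * k], where [k] divides [l * (p * k)] and
   the power sum is known exactly. *)
have size_sk : (size sk)%:R = (p%:R - 1) * (p ^ k)%:R :> rat.
  apply: (fmorph_inj (ratr : rat -> algC)); rewrite /= ratr_nat -(V_size k) //.
  congr ratr; rewrite /V (@scaled_sum_max _ _ _ _ _ _ (l * p)) ?muln_gt0 ?l_gt0 //; last lia.
  by rewrite dvdn_mull // dvdn_mull.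
have V_size1 i : ratr (V i) = (size sk)%:R :> algC -> V i = (p%:R - 1) * (p ^ k)%:R.
  by move=> E; rewrite -size_sk; apply: (fmorph_inj (ratr : rat -> algC)); rewrite /= E ratr_nat.
have abs_max : `|(p%:R - 1) * (p ^ k)%:R| = (p%:R - 1) * (p ^ k)%:R :> rat.
  by rewrite ger0_norm // (le_trans _ Vmax_big) // ltW.
have k_dvd_lp : (k %| l * p)%N.
  by apply: V_big => //; rewrite V_size1 ?abs_max // -[p in V p]muln1 V_size.
(* Such a [j] is prime to [p], so [k] divides gcd(l p, l j) = l. *)
suff [j /andP[j_gt0 j_lt] k_dvd_lj] : exists2 j, (0 < j < p)%N & (k %| l * j)%N.
  case/negP: k_ndvd_l; rewrite -(muln1 l).
  have <- : gcdn p j = 1%N.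
    by apply/eqP; rewrite -/(coprime p j) prime_coprime // gtnNdvd.
  by rewrite muln_gcdr dvdn_gcd k_dvd_lp.
have [p_l|p_nl] := boolP (p %| l)%N.
  exists 1%N => //; apply: V_big => //; rewrite V_size1 ?abs_max //.
  rewrite -U_sum // big_seq (eq_bigr (fun=> 1)) => [|a /sub_kl/g_sl/gE]; last first.
    by rewrite p_l expr1.
  by rewrite -big_seq.
(* If no [j] worked, every V j + p^k with 0 < j < p would be positive. But 1 + u + ... + u^(p-1) = 0
   for each eigenvalue makes the sum of these V j equal to minus the number of eigenvalues, so the
   total is 0. *)
have [[j j_lt] /= j_in|none] := pickP [pred j : 'I_p.-1 | k %| l * j.+1]%N.
  by exists j.+1 => //; lia.
have V_gt (j : 'I_p.-1) : 0 < V j.+1 + (p ^ k)%:R.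
  have : `|V j.+1| < (p ^ k)%:R.
    by rewrite ltNge; apply/negP => /(V_big j.+1 isT); have /= -> := none j.
  by rewrite ltr_norml -subr_gt0 opprK => /andP[].
have V_sum : \sum_(j < p.-1) (V j.+1 + (p ^ k)%:R) = 0.
  rewrite big_split /= sumr_const card_ord -[X in _ + X]mulr_natl -subn1 natrB // -size_sk.
  apply: (fmorph_inj (ratr : rat -> algC)); rewrite /= rmorphD rmorph_sum /= ratr_nat rmorph0.
  under eq_bigr => j _ do rewrite -U_sum //.
  rewrite exchange_big /= -sum1 -big_split big_seq big1 //= => a a_sk.
  have := gE _ (g_sl _ (sub_kl _ a_sk)); rewrite (negPf p_nl).
  move: (U a); case: (p) p_gt0 => // p' _ u.
  by rewrite big_ord_recl expr0 addrC subn1.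
have p1_gt0 : (0 < p.-1)%N by lia.
have /(_ (Ordinal p1_gt0) isT) E0 := psumr_eq0P (fun j _ => ltW (V_gt j)) V_sum.
by have := V_gt (Ordinal p1_gt0); rewrite E0 ltxx.
Qed.
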